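(* Let $\mathcal{D}=(V,E,F)$ be an infinite cellular decomposition of a non-compact surface $S$. In both hyperbolic and Euclidean background geometries, let $\delta$ be an arbitrarily small positive constant. If $\Theta\in(\delta,\pi-\delta)^E$ satisfies condition (C1) (see context), and there exists a positive constant $\hat d$ such that $d_i\le\hat d$ for all $v_i\in V$, then for any initial value $r(0)\in(0,\infty)^V$, the solution $r(t)$ to the combinatorial Ricci flow $$\frac{\mathrm{d}r_i}{\mathrm{d}t}=-K_i\,s(r_i),\qquad\forall v_i\in V,\ t\ge 0,$$ with initial value $r(0)$ is unique. Here $s(r_i)=r_i$ in Euclidean background geometry and $s(r_i)=\sinh r_i$ in hyperbolic background geometry.
   Context: $V,E,F$ are the vertices, edges and faces of $\mathcal{D}$; $j\sim i$ means $v_i,v_j$ are joined by an edge $[v_i,v_j]\in E$; $d_i$ is the degree of $v_i$ (number of edges at $v_i$); the 1-skeleton $(V,E)$ is assumed connected (graph distance between any two vertices is finite). $\Theta_{ij}=\Theta([v_i,v_j])$ is the intersection angle. Condition (C1): if edges $e_1,\dots,e_m$ form the boundary of a face, then $\sum_{l=1}^m\Theta(e_l)=(m-2)\pi$. A circle packing metric is a function $r:V\to(0,\infty)$, $r_i=r(v_i)$. For an edge $[v_i,v_j]$, consider the triangle $v_iv_jv_f$ in the Euclidean (resp. hyperbolic) plane with $|v_iv_f|=r_i$, $|v_jv_f|=r_j$ and $|v_iv_j|=l_{ij}$, where $l_{ij}=\sqrt{r_i^2+r_j^2+2r_ir_j\cos\Theta_{ij}}$ (resp. $l_{ij}=\cosh^{-1}(\cosh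 r_i\cosh r_j+\sinh r_i\sinh r_j\cos\Theta_{ij})$); the angle at $v_f$ is $\pi-\Theta_{ij}$. Let $\theta_{ij}$ be the inner angle at $v_i$. The discrete Gaussian (vertex) curvature is $2\pi$ minus the total cone angle at $v_i$, i.e. $K_i(r)=2\pi-2\sum_{j\sim i}\theta_{ij}(r_i,r_j)$. *)

(* Defs.v *)
From HB Require Import structures.
From Stdlib Require Import Relation_Operators.
From mathcomp Require Import all_boot all_order all_algebra.
From mathcomp Require Import all_classical all_reals all_analysis.

Set Implicit Arguments.
Unset Strict Implicit.
Unset Printing Implicit Defensive.

Import Order.TTheory GRing.Theory Num.Theory.
Import numFieldNormedType.Exports.

Local Open Scope classical_set_scope.
Local Open Scope ring_scope.

(** * Surfaces and cellular decompositions *)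

(* A topological surface without boundary. An injective continuous open map
   from the plane is a homeomorphism onto an open subset. *)
Definition surface (R : realType) (S : topologicalType) : Prop :=
  [/\ hausdorff_space S,
      @second_countable S &
      forall x : S, exists phi : R * R -> S,
        [/\ continuous phi, injective phi,
            (forall A : set (R * R), open A -> open (phi @` A)) &
            range phi x]].

Section Cells.
Variable R : realType.

Definition open_disk : set (R * R) := [set z | z.1 ^+ 2 + z.2 ^+ 2 < 1].
Definition closed_disk : set (R * R) := [set z | z.1 ^+ 2 + z.2 ^+ 2 <= 1].

(* The point of the unit circle at the fraction x of a full turn. *)
Definition circle_point (x : R) : R * R := (cos (2 * pi * x), sin (2 * pi * x)).

Variables (S : topologicalType) (V E F : choiceType).

(* A dart is an edge with an orientation: (e, false) follows the
   parametrization of e and (e, true) reverses it. *)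
Definition dart : choiceType := (E * bool)%type.

Definition dart_point (arc : E -> R -> S) (d : dart) (x : R) : S :=
  arc d.1 (if d.2 then 1 - x else x).

Definition open_cell (vtx : V -> S) (arc : E -> R -> S)
    (disk : F -> R * R -> S) (c : V + E + F) : set S :=
  match c with
  | inl (inl v) => [set vtx v]
  | inl (inr e) => arc e @` `]0, 1[
  | inr f => disk f @` open_disk
  end.

(* Loops and multiple edges are allowed. The characteristic map of a face is
   normalized so that it maps the m equal arcs of the unit circle successively
   onto the m darts of the boundary walk; this is no loss of generality, since
   a reparametrization of the circle extends radially to the disk. *)
Record cell_decomposition := CellDecomposition {
  vtx : V -> S;
  tail : E -> V;
  head : E -> V;
  arc : E -> R -> S;
  disk : F -> R * R -> S;
  bdry : F -> seq dart;
  arc_continuous : forall e, {within `[0, 1], continuous (arc e)};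
  arc_injective : forall e, {in `]0, 1[ &, injective (arc e)};
  arc_tail : forall e, arc e 0 = vtx (tail e);
  arc_head : forall e, arc e 1 = vtx (head e);
  disk_continuous : forall f, {within closed_disk, continuous (disk f)};
  disk_injective : forall f, {in open_disk &, injective (disk f)};
  bdry_nonempty : forall f, (0 < size (bdry f))%N;
  disk_bdry : forall f (d0 : dart) (k : nat) (x : R),
    (k < size (bdry f))%N -> 0 <= x <= 1 ->
    disk f (circle_point ((k%:R + x) / (size (bdry f))%:R)) =
    dart_point arc (nth d0 (bdry f) k) x;
  cells_disjoint : trivIset [set: V + E + F] (open_cell vtx arc disk);
  cells_cover : \bigcup_c open_cell vtx arc disk c = [set: S];
  cells_locally_finite : forall x : S, exists2 U : set S, nbhs x U &
    finite_set [set c | open_cell vtx arc disk c `&` U !=set0]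
}.

Variable D : cell_decomposition.

Definition source (d : dart) : V := if d.2 then head D d.1 else tail D d.1.
Definition target (d : dart) : V := if d.2 then tail D d.1 else head D d.1.

(* The edges at v, a loop being counted once for each of its two ends; its
   cardinality is the degree of v. When there are no loops and no multiple
   edges, target is a bijection from star v to the set of neighbours of v. *)
Definition star (v : V) : set dart := [set d | source d = v].

Definition adjacent (v w : V) : Prop :=
  exists d : dart, source d = v /\ target d = w.

Definition connected_skeleton : Prop :=
  forall v w : V, clos_refl_trans V adjacent v w.

Definition condition_C1 (Theta : E -> R) : Prop :=
  forall f : F,
    \sum_(d <- bdry D f) Theta d.1 = ((size (bdry D f))%:R - 2) * pi.

End Cells.

(** * Circle packing metrics and combinatorial curvature *)

Variant geometry := Euclidean | Hyperbolic.

Section Curvature.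
Variable R : realType.

Definition cosh (x : R) : R := (expR x + expR (- x)) / 2.
Definition sinh (x : R) : R := (expR x - expR (- x)) / 2.
Definition arcosh (x : R) : R := ln (x + Num.sqrt (x ^+ 2 - 1)).

Definition edge_length (g : geometry) (Th ri rj : R) : R :=
  match g with
  | Euclidean => Num.sqrt (ri ^+ 2 + rj ^+ 2 + 2 * ri * rj * cos Th)
  | Hyperbolic => arcosh (cosh ri * cosh rj + sinh ri * sinh rj * cos Th)
  end.

(* Inner angle, in a triangle with side lengths a, b, c, between the sides of
   lengths a and b (law of cosines). *)
Definition triangle_angle (g : geometry) (a b c : R) : R :=
  match g with
  | Euclidean => acos ((a ^+ 2 + b ^+ 2 - c ^+ 2) / (2 * a * b))
  | Hyperbolic => acos ((cosh a * cosh b - cosh c) / (sinh a * sinh b))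
  end.

(* Angle at v_i in the triangle v_i v_j v_f. *)
Definition theta (g : geometry) (Th ri rj : R) : R :=
  triangle_angle g ri (edge_length g Th ri rj) rj.

Definition flow_speed (g : geometry) (x : R) : R :=
  match g with Euclidean => x | Hyperbolic => sinh x end.

Variables (S : topologicalType) (V E F : choiceType).
Variable D : cell_decomposition R S V E F.

(* The sum is meaningful only if star D v is finite: a finitely supported sum
   is 0 by convention when its support is infinite. *)
Definition curvature (g : geometry) (Theta : E -> R) (r : V -> R) (v : V) : R :=
  2 * pi - 2 * \sum_(d \in star D v) theta g (Theta d.1) (r v) (r (target D d)).

(* The derivative at the initial time is one-sided; the values of r at negative
   times are irrelevant. *)
Definition ricci_flow_solution (g : geometry) (Theta : E -> R) (r0 : V -> R)
    (r : R -> V -> R) : Prop :=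
  let rhs (t : R) (v : V) : R := - curvature g Theta (r t) v * flow_speed g (r t v) in
  [/\ forall v, r 0 v = r0 v,
      forall (t : R) (v : V), 0 <= t -> 0 < r t v,
      forall (t : R) (v : V), 0 < t -> is_derive t (1 : R) (fun x : R => r x v) (rhs t v) &
      forall v : V, (r h v - r 0 v) / h @[h --> 0^'+] --> rhs 0 v].

End Curvature.

(* Main.v *)
Require Import Defs.
From HB Require Import structures.
From mathcomp Require Import all_boot all_order all_algebra.
From mathcomp Require Import all_classical all_reals all_analysis.
From mathcomp Require Import ring lra.

(** In the coordinate u = ln r (Euclidean) or u = ln (tanh (r / 2)) (hyperbolic)
    one has du = dr / s(r), so the flow reads du_i/dt = - K_i. The point is that
    in this coordinate every angle is Lipschitz with one and the same constant:
    theta_ij is the polar angle of the vector (n, m), where m = s(r_j) sin Theta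
    and n is r_i + r_j cos Theta, respectively
    sinh r_i cosh r_j + cosh r_i sinh r_j cos Theta, whence a direct computation
    of both partial derivatives gives
      |d theta_ij / d u_i|, |d theta_ij / d u_j| <= 1 / (1 + cos Theta_ij)
    for all radii (theta_lipschitz). In the hyperbolic case this rests on the
    inequality cosh l >= 1 + (1 + cos Theta) sinh r_i sinh r_j for the length l
    of the edge (cosh_side_ge), a form of cosh (r_i - r_j) >= 1. As
    Theta < pi - delta, the right-hand side is at most 1 / (1 - cos delta), and
    as the degrees are bounded, u |-> - K is globally Lipschitz for the supremum
    norm on functions on V.

    Although V is infinite, a difference w of two solutions with the same
    initial value has a finite supremum norm at each time: angles lie in
    [0, pi], so the curvatures are bounded and w grows at most linearly.
    Gronwall's argument therefore applies in the supremum norm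
    (gronwall_sup) and gives w = 0; as u is an injective function of r, the two
    solutions coincide. *)

Set Implicit Arguments.
Unset Strict Implicit.
Unset Printing Implicit Defensive.

Import Order.TTheory GRing.Theory Num.Theory.
Import numFieldNormedType.Exports.

Local Open Scope classical_set_scope.
Local Open Scope ring_scope.

(** * Comparison of increments and Gronwall's argument *)

(** Both g + f and g - f have a nonnegative derivative. Bounding |f'| by g'
    rather than by a constant serves twice: with g a change of coordinate it
    gives Lipschitz bounds in that coordinate, and with g an exponential it
    gives the integral estimate in Gronwall's argument. *)
Lemma increment_le (R : realType) (f g df dg : R -> R) (a b : R) :
  a <= b ->
  {within `[a, b], continuous f} -> {within `[a, b], continuous g} ->
  (forall x, a < x < b -> is_derive x (1 : R) f (df x)) ->
  (forall x, a < x < b -> is_derive x (1 : R) g (dg x)) ->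
  (forall x, a < x < b -> `|df x| <= dg x) ->
  `|f b - f a| <= g b - g a.
Proof.
move=> ab cf cg Df Dg fg.
have key (h dh : R -> R) : {within `[a, b], continuous h} ->
    (forall x, a < x < b -> is_derive x (1 : R) h (dh x)) ->
    (forall x, a < x < b -> 0 <= dh x) -> h a <= h b.
  move=> ch Dh dh0.
  apply: (@ger0_derive1_le_cc _ h a b) => //; rewrite ?in_itv/= ?lexx ?ab//.
  - by move=> x; rewrite in_itv/= => /Dh[].
  - move=> x; rewrite in_itv/= => xab.
    by rewrite derive1E (@derive_val _ _ _ _ _ _ _ (Dh x xab)) dh0.
rewrite ler_norml; apply/andP; split.
- suff : f a + g a <= f b + g b by lra.
  apply: (key (f + g) (fun x => df x + dg x)).
  + by move=> x; apply: cvgD; [exact: cf|exact: cg].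
  + by move=> x xab; apply: is_deriveD; [exact: Df|exact: Dg].
  + by move=> x /fg; rewrite ler_norml => /andP[]; lra.
- suff : g a - f a <= g b - f b by lra.
  apply: (key (g - f) (fun x => dg x - df x)).
  + by move=> x; apply: cvgB; [exact: cg|exact: cf].
  + by move=> x xab; apply: is_deriveB; [exact: Dg|exact: Df].
  + by move=> x /fg; rewrite ler_norml => /andP[]; lra.
Qed.

Lemma within_continuous_of_derive (R : realType) (f df : R -> R) (t : R) :
  0 < t ->
  (forall x : R, 0 < x -> is_derive x (1 : R) f (df x)) ->
  f x @[x --> 0^'+] --> f 0 -> {within `[0, t], continuous f}.
Proof.
move=> t0 Df f0.
have cf (x : R) : 0 < x -> {for x, continuous f}.
  by move=> /Df[+ _]; rewrite derivable1_diffP; exact: differentiable_continuous.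
apply/continuous_within_itvP => //; split => //.
- by move=> x; rewrite in_itv/= => /andP[+ _]; exact: cf.
- by apply: cvg_at_left_filter; exact: cf.
Qed.

(** Gronwall's argument in the supremum norm over an arbitrary index set. The
    uniform bound M on the derivatives starts it: it gives
    |w t i| <= M exp (l t) with a constant independent of i. The rate
    l = 2 L + 1 is so large that feeding such a bound back into the hypothesis
    halves its constant, which is therefore 0. *)
Lemma gronwall_sup (R : realType) (I : Type) (w dw : R -> I -> R) (L M : R) :
  0 <= L -> 0 <= M ->
  (forall (t : R) i, 0 < t -> is_derive t (1 : R) (w^~ i) (dw t i)) ->
  (forall i, w x i @[x --> 0^'+] --> w 0 i) ->
  (forall i, w 0 i = 0) ->
  (forall t i, 0 < t -> `|dw t i| <= M) ->
  (forall t A i, 0 < t -> (forall j, `|w t j| <= A) -> `|dw t i| <= L * A) ->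
  forall t i, 0 <= t -> w t i = 0.
Proof.
move=> L0 M0 Dw w0r w0 dwM dwL.
pose l := 2 * L + 1.
have l1 : 1 <= l by rewrite /l; lra.
pose h (B x : R) := B * expR (l * x).
have Dh B (x : R) : is_derive x (1 : R) (h B) (l * h B x).
  have De : is_derive x (1 : R) (fun y => expR (l * y)) (expR (l * x) * (l * 1)).
    exact: (@is_derive1_comp R (@expR R) (fun y => l * y) _ _ _
      (is_derive_expR _) (is_deriveZ l (is_derive_id x (1 : R)))).
  apply: is_derive_eq (is_deriveZ B De) _.
  by rewrite /h /GRing.scale/=; ring.
have step B : 0 <= B ->
    (forall t i, 0 < t -> `|dw t i| <= l * h B t) ->
    forall t i, 0 <= t -> `|w t i| <= h B t.
  move=> B0 dwB t i; rewrite le_eqVlt => /predU1P[<-|t0].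
    by rewrite w0 normr0 mulr_ge0// expR_ge0.
  have : `|w t i - w 0 i| <= h B t - h B 0.
    apply: (@increment_le R (w^~ i) (h B) (dw^~ i) (fun x => l * h B x)).
    - exact: ltW.
    - by apply: (@within_continuous_of_derive _ _ (dw^~ i)) => // x; exact: Dw.
    - by apply: derivable_within_continuous => x _; case: (Dh B x).
    - by move=> x /andP[x0 _]; exact: Dw.
    - by move=> x /andP[x0 _]; exact: dwB.
  rewrite w0 subr0 => /le_trans; apply; rewrite gerBl.
  by rewrite mulr_ge0// expR_ge0.
have halving n t i : 0 <= t -> `|w t i| <= h (M / 2 ^+ n) t.
  elim: n t i => [|n IHn].
    apply: step; first by rewrite expr0 divr1.
    move=> t i t0; apply: le_trans (dwM t i t0) _.
    rewrite /h expr0 divr1 mulrCA ler_peMr//.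
    by rewrite -[1]mulr1 ler_pM// -expR0 ler_expR mulr_ge0 ?ltW//; lra.
  apply: step; first by rewrite mulr_ge0// invr_ge0 exprn_ge0.
  move=> t i t0; apply: le_trans (dwL _ _ _ t0 (fun j => IHn t j (ltW t0))) _.
  have H0 : 0 <= h (M / 2 ^+ n) t.
    by rewrite mulr_ge0 ?expR_ge0// mulr_ge0// invr_ge0 exprn_ge0.
  rewrite (_ : h (M / 2 ^+ n.+1) t = h (M / 2 ^+ n) t / 2); last first.
    by rewrite /h exprSr invfM; ring.
  by rewrite /l; lra.
move=> t i t0; apply/eqP; rewrite -normr_le0 leNgt; apply/negP => wt0.
have := archi_boundP (_ : 0 <= h M t / `|w t i|).
rewrite divr_ge0 ?normr_ge0 ?mulr_ge0 ?expR_ge0// => /(_ isT).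
move: (Num.bound _) => n.
rewrite ltr_pdivrMr// => hn; have := halving n t i t0.
rewrite leNgt => /negP; apply.
rewrite /h mulrAC ltr_pdivrMr ?exprn_gt0// (lt_le_trans hn)// mulrC ler_pM2l//.
by rewrite -natrX ler_nat ltnW// ltn_expl.
Qed.

(** * Hyperbolic functions *)

Lemma cosh2_sinh2 (R : realType) (x : R) : cosh x ^+ 2 = 1 + sinh x ^+ 2.
Proof.
rewrite /cosh /sinh expRN; field.
by rewrite lt0r_neq0// expR_gt0.
Qed.

Lemma sinh_gt0 (R : realType) (x : R) : 0 < x -> 0 < sinh x.
Proof. by move=> x0; rewrite divr_gt0// subr_gt0 ltr_expR; lra. Qed.

Lemma cosh_ge1 (R : realType) (x : R) : 1 <= cosh x.
Proof.
rewrite -(@ler_pXn2r _ 2)// ?nnegrE ?ler01//.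
  by rewrite expr1n cosh2_sinh2 lerDl sqr_ge0.
by rewrite divr_ge0// addr_ge0// expR_ge0.
Qed.

(** By the subtraction formula this says that cosh (x - y) is at least 1. *)
Lemma coshM_ge (R : realType) (x y : R) :
  1 + sinh x * sinh y <= cosh x * cosh y.
Proof.
have := cosh_ge1 (x - y).
rewrite /cosh /sinh opprB !expRD !expRN.
set a := expR x; set b := expR y; set a' := a^-1; set b' := b^-1.
lra.
Qed.

(** The radicals cancel because (x + s)^-1 = x - s when s ^ 2 = x ^ 2 - 1. *)
Lemma cosh_sinh_arcosh (R : realType) (x : R) : 1 <= x ->
  cosh (arcosh x) = x /\ sinh (arcosh x) = Num.sqrt (x ^+ 2 - 1).
Proof.
move=> x1; have x21 : 0 <= x ^+ 2 - 1 by nra.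
have := sqrtr_ge0 (x ^+ 2 - 1); have := sqr_sqrtr x21.
rewrite /cosh /sinh /arcosh expRN; move: (Num.sqrt _) => s s2 s0.
rewrite lnK ?posrE; last by lra.
have -> : (x + s)^-1 = x - s.
  by apply: (mulIf (_ : x + s != 0)); [lra|rewrite mulVf; [nra|lra]].
by split; lra.
Qed.

Lemma is_derive_lincomb (R : realType) (f1 f2 : R -> R) (p q d1 d2 x : R) :
  is_derive x (1 : R) f1 d1 -> is_derive x (1 : R) f2 d2 ->
  is_derive x (1 : R) (fun y => p * f1 y + q * f2 y) (p * d1 + q * d2).
Proof.
move=> D1 D2; exact: is_deriveD (is_deriveZ p D1) (is_deriveZ q D2).
Qed.

Lemma is_derive_expRN (R : realType) (x : R) :
  is_derive x (1 : R) (fun y => expR (- y)) (expR (- x) * -1).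
Proof. exact: is_derive1_comp. Qed.

Lemma is_derive_sinh (R : realType) (x : R) :
  is_derive x (1 : R) (@sinh R) (cosh x).
Proof.
have := is_derive_lincomb 2^-1 (- 2^-1) (is_derive_expR x) (is_derive_expRN x).
rewrite (_ : (fun y => _) = @sinh R).
  by move=> D; apply: is_derive_eq D _; rewrite /cosh; lra.
by apply/funext => y; rewrite /sinh; lra.
Qed.

Lemma is_derive_cosh (R : realType) (x : R) :
  is_derive x (1 : R) (@cosh R) (sinh x).
Proof.
have := is_derive_lincomb 2^-1 2^-1 (is_derive_expR x) (is_derive_expRN x).
rewrite (_ : (fun y => _) = @cosh R).
  by move=> D; apply: is_derive_eq D _; rewrite /sinh; lra.
by apply/funext => y; rewrite /cosh; lra.
Qed.

(** * The inner angle as a polar angle *)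

(** The argument of n + i m when m is positive. *)
Definition polar_angle (R : realType) (n m : R) : R := pi / 2 - atan (n / m).

Lemma acosE_polar_angle (R : realType) (n m : R) : 0 < m ->
  acos (n / Num.sqrt (n ^+ 2 + m ^+ 2)) = polar_angle n m.
Proof.
move=> m0; rewrite /polar_angle; set y := n / m.
have -> : n / Num.sqrt (n ^+ 2 + m ^+ 2) = sin (atan y).
  have cy : 0 < cos (atan y).
    by apply: cos_gt0_pihalf; rewrite atan_gtNpi2 atan_ltpi2.
  have -> : sin (atan y) = y * cos (atan y).
    by rewrite -[X in X * _]atanK /tan divfK ?lt0r_neq0.
  have -> : n ^+ 2 + m ^+ 2 = m ^+ 2 * (1 + y ^+ 2) by rewrite /y; field; lra.
  rewrite cos_atan sqrtrM ?sqr_ge0// sqrtr_sqr gtr0_norm// /y invfM.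
  by rewrite mulrA.
rewrite -cosBpihalf -opprB cosN cosK// in_itv/=.
by have := atan_gtNpi2 y; have := atan_ltpi2 y; lra.
Qed.

Lemma is_derive_polar_angle (R : realType) (n m : R -> R) (dn dm x : R) :
  0 < m x -> is_derive x (1 : R) n dn -> is_derive x (1 : R) m dm ->
  is_derive x (1 : R) (fun y => polar_angle (n y) (m y))
    ((n x * dm - dn * m x) / (n x ^+ 2 + m x ^+ 2)).
Proof.
move=> m0 Dn Dm; have m0' : m x != 0 by rewrite lt0r_neq0.
have Dq : is_derive x (1 : R) (fun y => n y / m y) _ :=
  @is_deriveM _ _ n (fun y => (m y)^-1) _ _ _ _ Dn (is_deriveV m0' Dm).
have Da : is_derive x (1 : R) (fun y => atan (n y / m y)) _ :=
  @is_derive1_comp R (@atan R) (fun y => n y / m y) _ _ _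
    (is_derive1_atan _) Dq.
apply: is_derive_eq (is_deriveB (is_derive_cst (pi / 2 : R) x (1 : R)) Da) _.
rewrite /GRing.scale/=; field.
by rewrite m0'/= lt0r_neq0// ltr_wpDl ?sqr_ge0// exprn_gt0.
Qed.

(** angle_adj and angle_opp are the legs, adjacent and opposite to theta_ij, of
    a right triangle. In the Euclidean case it is cut out by the altitude from
    v_j and has hypotenuse l_ij, the adjacent leg being counted with sign; the
    hyperbolic expressions are its analogue, with hypotenuse sinh l_ij by
    sqr_adj_opp_Hyperbolic. *)
Definition angle_adj (R : realType) (g : geometry) (Th a b : R) : R :=
  match g with
  | Euclidean => a + b * cos Th
  | Hyperbolic => sinh a * cosh b + cosh a * sinh b * cos Th
  end.

Definition angle_opp (R : realType) (g : geometry) (Th b : R) : R :=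
  flow_speed g b * sin Th.

(** cosh l_ij, by the law of cosines. *)
Definition cosh_side (R : realType) (Th a b : R) : R :=
  cosh a * cosh b + sinh a * sinh b * cos Th.

Lemma flow_speed_gt0 (R : realType) g (x : R) : 0 < x -> 0 < flow_speed g x.
Proof. by case: g => // /sinh_gt0. Qed.

Lemma angle_opp_gt0 (R : realType) g (Th b : R) :
  0 < sin Th -> 0 < b -> 0 < angle_opp g Th b.
Proof. by move=> s0 b0; rewrite mulr_gt0// flow_speed_gt0. Qed.

Lemma cosD1_ge0 (R : realType) (Th : R) : 0 <= 1 + cos Th.
Proof. by have := cos_geN1 Th; lra. Qed.

Lemma sqr_sin (R : realType) (Th : R) : sin Th ^+ 2 = 1 - cos Th ^+ 2.
Proof. by have := cos2Dsin2 Th; lra. Qed.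

(** Completing the square in the law of cosines isolates the factor 1 + cos Th
    that controls the derivatives of the angle. *)
Lemma sqr_adj_opp_Euclidean (R : realType) (Th a b : R) :
  angle_adj Euclidean Th a b ^+ 2 + angle_opp Euclidean Th b ^+ 2 =
  (a - b) ^+ 2 + 2 * ((1 + cos Th) * (a * b)).
Proof.
have sc := sqr_sin Th.
by rewrite /angle_adj /angle_opp/=; ring: sc.
Qed.

Lemma cosh_side_ge (R : realType) (Th a b : R) :
  1 + (1 + cos Th) * (sinh a * sinh b) <= cosh_side Th a b.
Proof. by have := coshM_ge a b; rewrite /cosh_side; lra. Qed.

Lemma sqr_adj_opp_Hyperbolic (R : realType) (Th a b : R) :
  angle_adj Hyperbolic Th a b ^+ 2 + angle_opp Hyperbolic Th b ^+ 2 =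
  (cosh_side Th a b - 1) * (cosh_side Th a b + 1).
Proof.
have sc := sqr_sin Th; have ca := cosh2_sinh2 a; have cb := cosh2_sinh2 b.
by rewrite /angle_adj /angle_opp /cosh_side/=; ring: ca cb sc.
Qed.

(** Substituting the length of the edge into the law of cosines for the angle
    at v_i leaves the quotient adjacent / hypotenuse. *)
Lemma thetaE (R : realType) g (Th a b : R) :
  0 < sin Th -> 0 < a -> 0 < b ->
  theta g Th a b = polar_angle (angle_adj g Th a b) (angle_opp g Th b).
Proof.
move=> s0 a0 b0; have m0 := angle_opp_gt0 g s0 b0.
rewrite -acosE_polar_angle//.
have l0 : 0 < angle_adj g Th a b ^+ 2 + angle_opp g Th b ^+ 2.
  by rewrite ltr_wpDl ?sqr_ge0// exprn_gt0.
have sl0 : Num.sqrt (angle_adj g Th a b ^+ 2 + angle_opp g Th b ^+ 2) != 0.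
  by rewrite lt0r_neq0// sqrtr_gt0.
case: g m0 l0 sl0 => m0 l0; rewrite /theta /triangle_angle /edge_length.
- rewrite (_ : a ^+ 2 + b ^+ 2 + 2 * a * b * cos Th =
    angle_adj Euclidean Th a b ^+ 2 + angle_opp Euclidean Th b ^+ 2); last first.
    by rewrite sqr_adj_opp_Euclidean; ring.
  move=> l0'; congr acos; rewrite sqr_sqrtr ?ltW//.
  move: (Num.sqrt _) l0' => l l0'; rewrite sqr_adj_opp_Euclidean /angle_adj.
  by field; rewrite l0' lt0r_neq0.
- rewrite -/(cosh_side Th a b).
  have p0 : 0 < sinh a * sinh b by rewrite mulr_gt0 ?sinh_gt0.
  have A1 : 1 <= cosh_side Th a b.
    have := mulr_ge0 (cosD1_ge0 Th) (ltW p0).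
    by have := cosh_side_ge Th a b; lra.
  have [-> ->] := cosh_sinh_arcosh A1.
  rewrite (_ : cosh_side Th a b ^+ 2 - 1 =
    angle_adj Hyperbolic Th a b ^+ 2 + angle_opp Hyperbolic Th b ^+ 2); last first.
    by rewrite sqr_adj_opp_Hyperbolic; ring.
  move: (Num.sqrt _) => l l0'; congr acos; rewrite /cosh_side /angle_adj.
  have ca := cosh2_sinh2 a.
  by field: ca; rewrite l0' lt0r_neq0// sinh_gt0.
Qed.

Lemma theta_bounds (R : realType) g (Th a b : R) :
  0 < sin Th -> 0 < a -> 0 < b -> 0 <= theta g Th a b <= pi.
Proof.
move=> s0 a0 b0; rewrite thetaE// /polar_angle.
move: (angle_adj _ _ _ _ / _) => y.
by have := atan_gtNpi2 y; have := atan_ltpi2 y; lra.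
Qed.

(** * The flow coordinate and the Lipschitz bound for angles *)

(** The primitive of 1 / flow_speed: ln x, and ln (tanh (x / 2)). *)
Definition flow_coord (R : realType) (g : geometry) (x : R) : R :=
  match g with
  | Euclidean => ln x
  | Hyperbolic => ln (expR x - 1) - ln (expR x + 1)
  end.

Lemma is_derive_flow_coord (R : realType) g (x : R) : 0 < x ->
  is_derive x (1 : R) (flow_coord g) (flow_speed g x)^-1.
Proof.
case: g => x0; first exact: is_derive1_ln.
have ex1 : 1 < expR x by rewrite -expR0 ltr_expR.
have Dl (c : R) : 0 < expR x + c ->
    is_derive x (1 : R) (fun y => ln (expR y + c)) ((expR x + c)^-1 * expR x).
  move=> xc; apply: (@is_derive1_comp R (@ln R) (fun y => expR y + c)).
    exact: is_derive1_ln.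
  apply: is_derive_eq
    (is_deriveD (is_derive_expR x) (is_derive_cst c x (1 : R))) _.
  by rewrite addr0.
have D1 := Dl (-1) _; have D2 := Dl 1 _.
apply: is_derive_eq (is_deriveB (D1 _) (D2 _)) _; [lra|lra|].
rewrite /= /sinh expRN; field.
by rewrite !lt0r_neq0//; nra.
Qed.

Lemma flow_coord_inj (R : realType) g (a b : R) : 0 < a -> 0 < b ->
  flow_coord g a = flow_coord g b -> a = b.
Proof.
case: g => /= a0 b0; first by move/ln_inj; apply; rewrite posrE.
have ea1 : 1 < expR a by rewrite -expR0 ltr_expR.
have eb1 : 1 < expR b by rewrite -expR0 ltr_expR.
rewrite -!ln_div ?posrE; [|lra..].
move/ln_inj; rewrite !posrE !divr_gt0; [|lra..] => /(_ isT isT) /eqP.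
rewrite eqr_div ?lt0r_neq0; [|lra..] => /eqP e.
by apply: expR_inj; lra.
Qed.

(** The common end of the four computations of partial derivatives. There n / d
    is the derivative of the angle, d the squared hypotenuse and e the speed;
    q is the product of the two speeds, times cosh l in one of the cases. *)
Lemma partial_bound (R : realType) (Th K n d e q : R) :
  0 < d -> 0 < e -> 0 <= q -> 1 <= K * (1 + cos Th) ->
  `|n| * e = q * sin Th -> (1 + cos Th) * q <= d -> `|n / d| <= K / e.
Proof.
move=> d0 e0 q0 K1 ne qd; have c1 := cosD1_ge0 Th.
have K0 : 0 <= K by rewrite leNgt; apply/negP => K0; nra.
rewrite normrM normfV (gtr0_norm d0) ler_pdivrMr// mulrAC ler_pdivlMr// ne.
apply: le_trans (_ : q <= _); first by rewrite ler_piMr// sin_le1.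
apply: le_trans (_ : K * ((1 + cos Th) * q) <= _); last by rewrite ler_wpM2l.
by rewrite mulrA ler_peMl.
Qed.

Lemma is_derive_theta_l (R : realType) g (Th K b x : R) :
  0 < sin Th -> 1 <= K * (1 + cos Th) -> 0 < b -> 0 < x ->
  exists2 d, is_derive x (1 : R)
    (fun y => polar_angle (angle_adj g Th y b) (angle_opp g Th b)) d &
  `|d| <= K / flow_speed g x.
Proof.
move=> s0 K1 b0 x0.
have m0 := angle_opp_gt0 g s0 b0.
have den0 (n : R) : 0 < n ^+ 2 + angle_opp g Th b ^+ 2.
  by rewrite ltr_wpDl ?sqr_ge0// exprn_gt0.
have sx0 := flow_speed_gt0 g x0; have sb0 := flow_speed_gt0 g b0.
have p0 : 0 < flow_speed g x * flow_speed g b by exact: mulr_gt0.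
have q0 := mulr_ge0 (cosD1_ge0 Th) (ltW p0).
have Dm : is_derive x (1 : R) (fun _ : R => angle_opp g Th b) 0.
  exact: is_derive_cst.
case: g m0 den0 sx0 sb0 p0 q0 Dm => m0 den0 sx0 sb0 p0 q0 Dm.
- have Dn : is_derive x (1 : R) (fun y => angle_adj Euclidean Th y b) (1 + 0).
    exact: (is_deriveD (is_derive_id x (1 : R))
      (is_derive_cst (b * cos Th) x (1 : R))).
  eexists; first exact: (@is_derive_polar_angle _ _ (fun=> _) _ _ x m0 Dn Dm).
  apply: (@partial_bound _ Th _ _ _ _ (x * b)) => //; first exact: ltW.
    rewrite mulr0 addr0 sub0r mul1r normrN gtr0_norm// /angle_opp/=; ring.
  rewrite sqr_adj_opp_Euclidean.
  by move: q0; have := sqr_ge0 (x - b); rewrite /=; lra.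
- have Dn : is_derive x (1 : R) (fun y => angle_adj Hyperbolic Th y b)
      (cosh_side Th x b).
    have := is_derive_lincomb (cosh b) (sinh b * cos Th)
      (is_derive_sinh x) (is_derive_cosh x).
    rewrite (_ : (fun y => _) = (fun y => angle_adj Hyperbolic Th y b)).
      by move=> D; apply: is_derive_eq D _; rewrite /cosh_side; ring.
    by apply/funext => y; rewrite /angle_adj; ring.
  have A1 := cosh_side_ge Th x b; rewrite /= in p0 q0.
  have A0 : 1 <= cosh_side Th x b by lra.
  eexists; first exact: (@is_derive_polar_angle _ _ (fun=> _) _ _ x m0 Dn Dm).
  (* The extra factor cosh l in the numerator is absorbed by cosh l + 1 in
     sinh l ^ 2 = (cosh l - 1) (cosh l + 1). *)
  apply: (@partial_bound _ Th _ _ _ _ (cosh_side Th x b * (sinh x * sinh b))) => //.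
  + by apply: mulr_ge0; lra.
  + rewrite mulr0 sub0r normrN gtr0_norm; last by rewrite mulr_gt0//; lra.
    by rewrite /angle_opp/=; ring.
  + by rewrite sqr_adj_opp_Hyperbolic mulrCA mulrC; apply: ler_pM; lra.
Qed.

Lemma is_derive_theta_r (R : realType) g (Th K a x : R) :
  0 < sin Th -> 1 <= K * (1 + cos Th) -> 0 < a -> 0 < x ->
  exists2 d, is_derive x (1 : R)
    (fun y => polar_angle (angle_adj g Th a y) (angle_opp g Th y)) d &
  `|d| <= K / flow_speed g x.
Proof.
move=> s0 K1 a0 x0.
have m0 := angle_opp_gt0 g s0 x0.
have den0 (n : R) : 0 < n ^+ 2 + angle_opp g Th x ^+ 2.
  by rewrite ltr_wpDl ?sqr_ge0// exprn_gt0.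
have sx0 := flow_speed_gt0 g x0; have sa0 := flow_speed_gt0 g a0.
have p0 : 0 < flow_speed g a * flow_speed g x by exact: mulr_gt0.
have q0 := mulr_ge0 (cosD1_ge0 Th) (ltW p0).
case: g m0 den0 sx0 sa0 p0 q0 => m0 den0 sx0 sa0 p0 q0.
- have Dm : is_derive x (1 : R) (angle_opp Euclidean Th) (sin Th).
    have := is_derive_lincomb (sin Th) 0
      (is_derive_id x (1 : R)) (is_derive_id x (1 : R)).
    rewrite (_ : (fun y => _) = angle_opp Euclidean Th).
      by move=> D; apply: is_derive_eq D _; ring.
    by apply/funext => y; rewrite /angle_opp/=; ring.
  have Dn : is_derive x (1 : R) (fun y => angle_adj Euclidean Th a y) (cos Th).
    have := is_derive_lincomb (cos Th) a
      (is_derive_id x (1 : R)) (is_derive_cst (1 : R) x (1 : R)).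
    rewrite (_ : (fun y => _) = (fun y => angle_adj Euclidean Th a y)).
      by move=> D; apply: is_derive_eq D _; ring.
    by apply/funext => y; rewrite /angle_adj/= /cst; ring.
  eexists; first exact: is_derive_polar_angle m0 Dn Dm.
  apply: (@partial_bound _ Th _ _ _ _ (a * x)) => //; first exact: ltW.
    rewrite (_ : _ - _ = a * sin Th); last by rewrite /angle_adj /angle_opp/=; ring.
    by rewrite gtr0_norm ?mulr_gt0//=; ring.
  rewrite sqr_adj_opp_Euclidean.
  by move: q0; have := sqr_ge0 (a - x); rewrite /=; lra.
- have Dm : is_derive x (1 : R) (angle_opp Hyperbolic Th) (cosh x * sin Th).
    have := is_derive_lincomb (sin Th) 0 (is_derive_sinh x) (is_derive_sinh x).
    rewrite (_ : (fun y => _) = angle_opp Hyperbolic Th).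
      by move=> D; apply: is_derive_eq D _; ring.
    by apply/funext => y; rewrite /angle_opp/=; ring.
  have Dn : is_derive x (1 : R) (fun y => angle_adj Hyperbolic Th a y)
      (sinh a * sinh x + cosh a * cos Th * cosh x : R).
    have := is_derive_lincomb (sinh a) (cosh a * cos Th)
      (is_derive_cosh x) (is_derive_sinh x).
    rewrite (_ : (fun y => _) = (fun y => angle_adj Hyperbolic Th a y)) //.
    by apply/funext => y; rewrite /angle_adj; ring.
  have A1 := cosh_side_ge Th a x; rewrite /= in p0 q0.
  eexists; first exact: is_derive_polar_angle m0 Dn Dm.
  apply: (@partial_bound _ Th _ _ _ _ (sinh a * sinh x)) => //; first exact: ltW.
  + have cx := cosh2_sinh2 x.
    rewrite (_ : _ - _ = sinh a * sin Th); last first.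
      by rewrite /angle_adj /angle_opp/=; ring: cx.
    by rewrite gtr0_norm ?(mulr_gt0 sa0 s0)//= mulrAC.
  + rewrite sqr_adj_opp_Hyperbolic.
    apply: le_trans (_ : cosh_side Th a x - 1 <= _); first by lra.
    by rewrite ler_peMr; lra.
Qed.

Lemma lipschitz_in_flow_coord (R : realType) g (K : R) (f : R -> R) :
  (forall x : R, 0 < x -> exists2 d : R, is_derive x (1 : R) f d &
     `|d| <= K / flow_speed g x) ->
  forall a b, 0 < a -> 0 < b ->
  `|f a - f b| <= K * `|flow_coord g a - flow_coord g b|.
Proof.
move=> Df; suff h (a b : R) : 0 < a -> 0 < b -> a <= b ->
    `|f a - f b| <= K * `|flow_coord g a - flow_coord g b|.
  move=> a b a0 b0; have [|/ltW] := leP a b; first exact: h.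
  by move=> ba; rewrite distrC (distrC (flow_coord g a)); exact: h.
move=> a0 b0 ab.
have DF (x : R) : 0 < x -> is_derive x (1 : R) (fun y => K * flow_coord g y)
    (K / flow_speed g x).
  by move=> x0; exact: is_deriveZ (is_derive_flow_coord g x0).
have K0 : 0 <= K.
  have [d _ dK] := Df _ a0; have := le_trans (normr_ge0 d) dK.
  by rewrite pmulr_lge0// invr_gt0 flow_speed_gt0.
have pos (x : R) : x \in `[a, b] -> 0 < x.
  by rewrite in_itv/= => /andP[ax _]; exact: lt_le_trans ax.
have posoo (x : R) : a < x < b -> 0 < x.
  by move=> /andP[ax _]; exact: lt_trans ax.
have inc : `|f b - f a| <= K * flow_coord g b - K * flow_coord g a.
  apply: (@increment_le R f (fun y => K * flow_coord g y) (fun x => 'D_1 f x)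
    (fun x => K / flow_speed g x)) => //.
  - by apply: derivable_within_continuous => x /pos /Df[d []].
  - by apply: derivable_within_continuous => x /pos /DF[].
  - by move=> x /posoo /Df[d D _]; apply: (is_derive_eq D); rewrite derive_val.
  - by move=> x /posoo /DF.
  - by move=> x /posoo /Df[d D]; rewrite derive_val.
rewrite distrC (le_trans inc)// -mulrBr ler_wpM2l//.
by rewrite distrC ler_norm.
Qed.

(** The uniform Lipschitz bound, obtained by moving one radius at a time. *)
Lemma theta_lipschitz (R : realType) g (Th K a b a' b' : R) :
  0 < sin Th -> 1 <= K * (1 + cos Th) ->
  0 < a -> 0 < b -> 0 < a' -> 0 < b' ->
  `|theta g Th a b - theta g Th a' b'| <=
  K * `|flow_coord g a - flow_coord g a'| +
  K * `|flow_coord g b - flow_coord g b'|.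
Proof.
move=> s0 K1 a0 b0 a'0 b'0; rewrite !thetaE//.
apply: (le_trans (ler_distD
  (polar_angle (angle_adj g Th a' b) (angle_opp g Th b)) _ _)).
apply: lerD.
- apply: (lipschitz_in_flow_coord (f := fun y =>
    polar_angle (angle_adj g Th y b) (angle_opp g Th b))) => // x x0.
  exact: is_derive_theta_l.
- apply: (lipschitz_in_flow_coord (f := fun y =>
    polar_angle (angle_adj g Th a' y) (angle_opp g Th y))) => // x x0.
  exact: is_derive_theta_r.
Qed.

Lemma intersection_angle_bounds (R : realType) (delta Th : R) :
  0 < delta -> delta < Th < pi - delta ->
  0 < sin Th /\ 1 <= (1 - cos delta)^-1 * (1 + cos Th).
Proof.
move=> d0 /andP[dT Td]; split; first by apply: sin_gt0_pi; lra.
have h1 : cos (pi - delta) < cos Th by rewrite ltr_cos// in_itv/=; lra.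
have h2 : cos delta < cos 0 by rewrite ltr_cos// in_itv/=; lra.
rewrite mulrC ler_pdivlMr; last by rewrite cos0 in h2; lra.
move: h1; rewrite addrC cosDpi cosN; lra.
Qed.

(** * Uniqueness of the flow *)

Lemma fsum_dist_le (R : realType) (T : choiceType) (A : set T) (n : nat)
    (f h : T -> R) (c : R) :
  0 <= c -> (A #<= `I_n)%card ->
  (forall x, A x -> `|f x - h x| <= c) ->
  `|\sum_(x \in A) f x - \sum_(x \in A) h x| <= c *+ n.
Proof.
move=> c0 An fh; have Afin : finite_set A by apply/finite_set_leP; exists n.
rewrite !fsbig_finite// -sumrB.
have sA x : x \in finmap.enum_fset (fset_set A) -> A x.
  by move=> xs; apply/set_mem; rewrite -(in_fset_set Afin).
have sn := geq_card_fset_set An.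
move: (finmap.enum_fset _) sA sn => s sA sn.
apply: le_trans (ler_norm_sum _ _ _) _.
apply: (@le_trans _ R (\sum_(i <- s) c)).
  by rewrite !big_seq; apply: ler_sum => x xs; exact/fh/sA.
by rewrite big_const_seq count_predT iter_addr_0 ler_wpMn2l.
Qed.

(** The factor s(r_i) of the flow cancels the derivative 1 / s(r_i) of the
    coordinate. Right continuity at time 0 follows from the one-sided derivative
    there. *)
Lemma flow_coord_solution (R : realType) (S : topologicalType)
    (V E F : choiceType) (D : cell_decomposition R S V E F)
    g (Theta : E -> R) (r0 : V -> R) (r : R -> V -> R) :
  ricci_flow_solution D g Theta r0 r ->
  (forall (t : R) v, 0 < t -> is_derive t (1 : R) (fun x => flow_coord g (r x v))
    (- curvature D g Theta (r t) v)) /\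
  (forall v, flow_coord g (r x v) @[x --> 0^'+] --> flow_coord g (r 0 v)).
Proof.
move=> [_ rpos Dr D0]; split=> [t v t0|v].
  have rt0 : 0 < r t v by exact/rpos/ltW.
  have := @is_derive1_comp R (flow_coord g) (fun x => r x v) _ _ _
    (is_derive_flow_coord g rt0) (Dr t v t0).
  move=> Dc; apply: is_derive_eq Dc _.
  by rewrite mulrC mulfK// lt0r_neq0// flow_speed_gt0.
have r00 : 0 < r 0 v by exact: rpos.
apply: (@continuous_cvg _ _ _ _ _ (fun x => r x v)).
  apply: differentiable_continuous; apply/derivable1_diffP.
  by case: (is_derive_flow_coord g r00).
have h0 : h @[h --> (0 : R)^'+] --> (0 : R) by exact: cvg_at_right_filter cvg_id.
have H : r 0 v + (r h v - r 0 v) / h * h @[h --> 0^'+] --> r 0 v.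
  rewrite -[X in _ --> X]addr0 -[X in _ --> _ + X](mulr0
    (- curvature D g Theta (r 0) v * flow_speed g (r 0 v))).
  by apply: cvgD; [exact: cvg_cst|apply: cvgM; [exact: D0|exact: h0]].
apply: cvg_trans H; apply: near_eq_cvg.
near=> h.
have hn0 : h != 0 by rewrite lt0r_neq0.
by rewrite /cst/= divfK// addrC subrK.
Unshelve. all: by end_near.
Qed.

Theorem theorem1p6 (R : realType) (g : geometry)
    (S : topologicalType) (V E F : choiceType)
    (D : cell_decomposition R S V E F)
    (delta : R) (Theta : E -> R) (dhat : nat) (r0 : V -> R)
    (hS : surface R S) (hSnc : ~ compact [set: S])
    (hVinf : infinite_set [set: V])
    (hconn : connected_skeleton D)
    (hdelta : 0 < delta)
    (hTheta : forall e : E, delta < Theta e < pi - delta)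
    (hC1 : condition_C1 D Theta)
    (hdeg : forall v : V, (star D v #<= `I_dhat)%card)
    (hr0 : forall v : V, 0 < r0 v) :
  forall r1 r2 : R -> V -> R,
    ricci_flow_solution D g Theta r0 r1 ->
    ricci_flow_solution D g Theta r0 r2 ->
    forall (t : R) (v : V), 0 <= t -> r1 t v = r2 t v.
Proof.
move=> r1 r2 sol1 sol2.
have [Du1 u1r] := flow_coord_solution sol1.
have [Du2 u2r] := flow_coord_solution sol2.
have [r10 r1pos _ _] := sol1; have [r20 r2pos _ _] := sol2.
pose K := (1 - cos delta)^-1.
have K0 : 0 <= K by rewrite invr_ge0 subr_ge0 cos_le1.
have angles e := intersection_angle_bounds hdelta (hTheta e).
pose w t v := flow_coord g (r1 t v) - flow_coord g (r2 t v).
pose dw t v := - curvature D g Theta (r1 t) v + curvature D g Theta (r2 t) v.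
have dw_le t v c : 0 <= c -> (forall d, star D v d ->
    `|theta g (Theta d.1) (r1 t v) (r1 t (target D d)) -
      theta g (Theta d.1) (r2 t v) (r2 t (target D d))| <= c) ->
    `|dw t v| <= 2 * (c *+ dhat).
  move=> c0 hc; pose cone (r : R -> V -> R) := \sum_(d \in star D v)
    theta g (Theta d.1) (r t v) (r t (target D d)).
  have : `|cone r1 - cone r2| <= c *+ dhat by exact: fsum_dist_le.
  have -> : dw t v = - (2 * pi - 2 * cone r1) + (2 * pi - 2 * cone r2) by [].
  move: (cone r1) (cone r2) => c1 c2 c12.
  rewrite (_ : - (2 * pi - 2 * c1) + (2 * pi - 2 * c2) = 2 * (c1 - c2)); last first.
    by ring.
  by rewrite normrM ger0_norm// ler_wpM2l.
suff w0 t v : 0 <= t -> w t v = 0.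
  move=> t v t0; apply: (@flow_coord_inj _ g); [exact: r1pos|exact: r2pos|].
  by apply/eqP; rewrite -subr_eq0; apply/eqP; exact: w0.
apply: (@gronwall_sup R V w dw (2 * ((K + K) *+ dhat)) (2 * (pi *+ dhat))).
- by rewrite mulr_ge0// mulrn_wge0// addr_ge0.
- by rewrite mulr_ge0// mulrn_wge0// pi_ge0.
- move=> {}t {}v t0; apply: is_derive_eq (is_deriveB (Du1 t v t0) (Du2 t v t0)) _.
  by rewrite /dw opprK.
- by move=> {}v; exact: cvgB (u1r v) (u2r v).
- by move=> {}v; rewrite /w r10 r20 subrr.
- move=> {}t {}v t0; apply: dw_le => [|d _]; first exact: pi_ge0.
  have [s0 _] := angles d.1.
  have tb r : (forall t v, 0 <= t -> 0 < r t v) ->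
      0 <= theta g (Theta d.1) (r t v) (r t (target D d)) <= pi.
    by move=> rpos; apply: theta_bounds => //; exact/rpos/ltW.
  move: (tb _ r1pos) (tb _ r2pos); move: (theta _ _ _ _) (theta _ _ _ _).
  by move=> x y xpi ypi; rewrite ler_norml; lra.
- move=> {}t A {}v t0 wA.
  have A0 : 0 <= A := le_trans (normr_ge0 _) (wA v).
  rewrite -mulrA [_ *+ dhat * _]mulrnAl.
  apply: dw_le => [|d _]; first by rewrite mulr_ge0// addr_ge0.
  have [s0 K1] := angles d.1.
  have p1 u : 0 < r1 t u by exact/r1pos/ltW.
  have p2 u : 0 < r2 t u by exact/r2pos/ltW.
  apply: le_trans (theta_lipschitz g s0 K1 (p1 v) (p1 _) (p2 v) (p2 _)) _.
  by rewrite mulrDl lerD// ler_wpM2l//; exact: wA.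
Qed.
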